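(* Let $t$ be a term of $\Lambda_B$. If $\Gamma;\Delta\vdash t:A$ is derivable in $\mathbf{DLAL_B}$, then $t$ has a unique $\beta\delta$-normal form.
   Context: System $\mathbf{DLAL_B}$. Types: $A,B::=\alpha\mid A\multimap B\mid A\Rightarrow B\mid \S A\mid \forall\alpha.A\mid \mathbf{Bool}$. Terms of $\Lambda_B$: $t,u,v::=x\mid F\mid T\mid \lambda x.t\mid t\,u\mid \mathrm{if}\ t\ \mathrm{then}\ u\ \mathrm{else}\ v$. Besides $\beta$-reduction there is $\delta$-reduction, the contextual closure of $(\mathrm{if}\ T\ \mathrm{then}\ u\ \mathrm{else}\ v)\to u$ and $(\mathrm{if}\ F\ \mathrm{then}\ u\ \mathrm{else}\ v)\to v$; $\beta\delta$-reduction is their union. Judgements are $\Gamma;\Delta\vdash t:A$ where $\Gamma$ (non-linear) and $\Delta$ (linear) assign types to distinct variables, with disjoint domains. Rules: (Id) $;x:A\vdash x:A$. ($\multimap$i) from $\Gamma;\Delta,x:A\vdash t:B$ infer $\Gamma;\Delta\vdash\lambda x.t:A\multimap B$. ($\multimap$e) from $\Gamma_1;\Delta_1\vdash t:A\multimap B$ and $\Gamma_2;\Delta_2\vdash u:A$ infer $\Gamma_1,\Gamma_2;\Delta_1,\Delta_2\vdash t\,u:B$. ($\Rightarrow$i) from $\Gamma,x:A;\Delta\vdash t:B$ infer $\Gamma;\Delta\vdash \lambda x.t:A\Rightarrow B$. ($\Rightarrow$e) from $\Gamma;\Delta\vdash t:A\Rightarrow B$ and $;z:C\vdash u:A$ infer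 $\Gamma,z:C;\Delta\vdash t\,u:B$ (the right premise may also be $;\vdash u:A$, with conclusion $\Gamma;\Delta\vdash t\,u:B$). (Weak) from $\Gamma_1;\Delta_1\vdash t:A$ infer $\Gamma_1,\Gamma_2;\Delta_1,\Delta_2\vdash t:A$. (Cntr) from $x_1:A,x_2:A,\Gamma;\Delta\vdash t:B$ infer $x:A,\Gamma;\Delta\vdash t[x/x_1,x/x_2]:B$. ($\S$i) from $;\Gamma,\Delta\vdash t:A$ infer $\Gamma;\S\Delta\vdash t:\S A$ ($\S\Delta$ prefixes $\S$ to every type of $\Delta$). ($\S$e) from $\Gamma_1;\Delta_1\vdash u:\S A$ and $\Gamma_2;x:\S A,\Delta_2\vdash t:B$ infer $\Gamma_1,\Gamma_2;\Delta_1,\Delta_2\vdash t[u/x]:B$. ($\forall$i) from $\Gamma;\Delta\vdash t:A$ infer $\Gamma;\Delta\vdash t:\forall\alpha.A$ if $\alpha$ is not free in $\Gamma,\Delta$. ($\forall$e) from $\Gamma;\Delta\vdash t:\forall\alpha.A$ infer $\Gamma;\Delta\vdash t:A[B/\alpha]$. ($B_0$i) $;\vdash F:\mathbf{Bool}$; ($B_1$i) $;\vdash T:\mathbf{Bool}$. ($B$e) from $\Gamma;\Delta\vdash M_0:\S^k\mathbf{Bool}$ ($k\in\mathbb{N}$), $\Gamma;\Delta\vdash M_1:A$, $\Gamma;\Delta\vdash M_2:A$ infer $\Gamma;\Delta\vdash \mathrm{if}\ M_0\ \mathrm{then}\ M_1\ \mathrm{else}\ M_2:A$. *)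

(* Defs.v *)
From Stdlib Require Import Relations.
From mathcomp Require Import all_boot.
From mathcomp Require Import finmap.

Set Implicit Arguments.
Unset Strict Implicit.
Unset Printing Implicit Defensive.

(* Type and term variables are natural numbers.  To quotient by
   alpha-equivalence, binders use de Bruijn indices: a free variable [x] is
   written with index [x] outside all binders, and [x + k] under [k] binders.
   Thus every element of [ty] and of [term] denotes exactly one
   alpha-equivalence class.  The operators [All] and [Lam] below bind a named
   free variable, so that the typing rules can be written with names. *)

Inductive ty : Type :=
  | TVar of nat
  | Lolli of ty & ty
  | Imp of ty & ty
  | Sec of ty
  | TAll of ty
  | TBool.

Inductive term : Type :=
  | Var of nat
  | FF
  | TT
  | Abs of term
  | App of term & term
  | If of term & term & term.

Definition up_ren (f : nat -> nat) (n : nat) : nat :=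
  if n is m.+1 then (f m).+1 else 0.

(* The renaming that turns the free variable [x] into the index bound by a
   new outermost binder. *)
Definition bind_var (x y : nat) : nat := if y == x then 0 else y.+1.

Fixpoint tren (f : nat -> nat) (A : ty) : ty :=
  match A with
  | TVar a => TVar (f a)
  | Lolli A B => Lolli (tren f A) (tren f B)
  | Imp A B => Imp (tren f A) (tren f B)
  | Sec A => Sec (tren f A)
  | TAll A => TAll (tren (up_ren f) A)
  | TBool => TBool
  end.

Definition tup (s : nat -> ty) (n : nat) : ty :=
  if n is m.+1 then tren succn (s m) else TVar 0.

Fixpoint tsubst (s : nat -> ty) (A : ty) : ty :=
  match A with
  | TVar a => s a
  | Lolli A B => Lolli (tsubst s A) (tsubst s B)
  | Imp A B => Imp (tsubst s A) (tsubst s B)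
  | Sec A => Sec (tsubst s A)
  | TAll A => TAll (tsubst (tup s) A)
  | TBool => TBool
  end.

(* A[B/a] *)
Definition tsubst1 (a : nat) (B A : ty) : ty :=
  tsubst (fun b => if b == a then B else TVar b) A.

(* forall a. A *)
Definition All (a : nat) (A : ty) : ty := TAll (tren (bind_var a) A).

Fixpoint tfree (a : nat) (A : ty) : bool :=
  match A with
  | TVar b => b == a
  | Lolli A B => tfree a A || tfree a B
  | Imp A B => tfree a A || tfree a B
  | Sec A => tfree a A
  | TAll A => tfree a.+1 A
  | TBool => false
  end.

Fixpoint ren (f : nat -> nat) (t : term) : term :=
  match t with
  | Var x => Var (f x)
  | FF => FF
  | TT => TT
  | Abs t => Abs (ren (up_ren f) t)
  | App t u => App (ren f t) (ren f u)
  | If t u v => If (ren f t) (ren f u) (ren f v)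
  end.

Definition up (s : nat -> term) (n : nat) : term :=
  if n is m.+1 then ren succn (s m) else Var 0.

Fixpoint subst (s : nat -> term) (t : term) : term :=
  match t with
  | Var x => s x
  | FF => FF
  | TT => TT
  | Abs t => Abs (subst (up s) t)
  | App t u => App (subst s t) (subst s u)
  | If t u v => If (subst s t) (subst s u) (subst s v)
  end.

(* t[u/x] *)
Definition subst1 (x : nat) (u t : term) : term :=
  subst (fun y => if y == x then u else Var y) t.

(* lambda x. t *)
Definition Lam (x : nat) (t : term) : term := Abs (ren (bind_var x) t).

(* Contractum of the redex [App (Abs t) u]: index 0 is replaced by [u] and the
   other indices are decremented. *)
Definition inst (u t : term) : term :=
  subst (fun n => if n is m.+1 then Var m else u) t.

Inductive beta_root : relation term :=
  | beta_redex t u : beta_root (App (Abs t) u) (inst u t).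

Inductive delta_root : relation term :=
  | delta_T u v : delta_root (If TT u v) u
  | delta_F u v : delta_root (If FF u v) v.

Inductive ctx_closure (R : relation term) : relation term :=
  | cc_root t t' : R t t' -> ctx_closure R t t'
  | cc_abs t t' : ctx_closure R t t' -> ctx_closure R (Abs t) (Abs t')
  | cc_appl t t' u : ctx_closure R t t' -> ctx_closure R (App t u) (App t' u)
  | cc_appr t u u' : ctx_closure R u u' -> ctx_closure R (App t u) (App t u')
  | cc_if0 t t' u v :
      ctx_closure R t t' -> ctx_closure R (If t u v) (If t' u v)
  | cc_if1 t u u' v :
      ctx_closure R u u' -> ctx_closure R (If t u v) (If t u' v)
  | cc_if2 t u v v' :
      ctx_closure R v v' -> ctx_closure R (If t u v) (If t u v').

Definition beta : relation term := ctx_closure beta_root.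
Definition delta : relation term := ctx_closure delta_root.
Definition betadelta : relation term := union term beta delta.

Definition normal (t : term) : Prop := ~ exists u, betadelta t u.

Definition is_normal_form_of (t n : term) : Prop :=
  clos_refl_trans term betadelta t n /\ normal n.

Local Open Scope fset_scope.
Local Open Scope fmap_scope.

Definition ctx : Type := {fmap nat -> ty}.

Definition sing (x : nat) (A : ty) : ctx := [fmap].[x <- A].

Definition secctx (D : ctx) : ctx := [fmap x : domf D => Sec (D x)].

Definition pairwise_disjoint (Gs : seq ctx) : bool :=
  pairwise (fun G H : ctx => [disjoint domf G & domf H]) Gs.

Definition tfree_ctx (a : nat) (G : ctx) : Prop :=
  exists x B, G.[? x] = Some B /\ tfree a B.

(* [derivable G D t A] is the judgement G; D |- t : A.  [catf], the union of
   finite maps, is right-biased, hence the disjointness side conditions;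
   together with the freshness conditions they ensure that the two contexts of
   every derivable judgement have disjoint domains.  In [d_cntr] and [d_sece]
   the variables [x1], [x2], resp. [x], disappear from the conclusion and may
   thus be reused there. *)
Inductive derivable : ctx -> ctx -> term -> ty -> Prop :=
  | d_id x A :
      derivable [fmap] (sing x A) (Var x) A
  | d_lollii (G D : ctx) x t A B :
      x \notin domf D ->
      derivable G D.[x <- A] t B ->
      derivable G D (Lam x t) (Lolli A B)
  | d_lollie (G1 D1 G2 D2 : ctx) t u A B :
      pairwise_disjoint [:: G1; D1; G2; D2] ->
      derivable G1 D1 t (Lolli A B) ->
      derivable G2 D2 u A ->
      derivable (catf G1 G2) (catf D1 D2) (App t u) B
  | d_impi (G D : ctx) x t A B :
      x \notin domf G ->
      derivable G.[x <- A] D t B ->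
      derivable G D (Lam x t) (Imp A B)
  | d_impe (G D : ctx) z t u A B C :
      z \notin domf G -> z \notin domf D ->
      derivable G D t (Imp A B) ->
      derivable [fmap] (sing z C) u A ->
      derivable G.[z <- C] D (App t u) B
  | d_impe0 (G D : ctx) t u A B :
      derivable G D t (Imp A B) ->
      derivable [fmap] [fmap] u A ->
      derivable G D (App t u) B
  | d_weak (G1 D1 G2 D2 : ctx) t A :
      pairwise_disjoint [:: G1; D1; G2; D2] ->
      derivable G1 D1 t A ->
      derivable (catf G1 G2) (catf D1 D2) t A
  | d_cntr (G D : ctx) x1 x2 x t A B :
      x1 != x2 -> x1 \notin domf G -> x2 \notin domf G ->
      x \notin domf G -> x \notin domf D ->
      derivable G.[x1 <- A].[x2 <- A] D t B ->
      derivable G.[x <- A] D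
        (ren (fun y => if (y == x1) || (y == x2) then x else y) t) B
  | d_seci (G D : ctx) t A :
      pairwise_disjoint [:: G; D] ->
      derivable [fmap] (catf G D) t A ->
      derivable G (secctx D) t (Sec A)
  | d_sece (G1 D1 G2 D2 : ctx) x t u A B :
      pairwise_disjoint [:: G1; D1; G2; D2] -> x \notin domf D2 ->
      derivable G1 D1 u (Sec A) ->
      derivable G2 D2.[x <- Sec A] t B ->
      derivable (catf G1 G2) (catf D1 D2) (subst1 x u t) B
  | d_alli (G D : ctx) a t A :
      ~ tfree_ctx a G -> ~ tfree_ctx a D ->
      derivable G D t A ->
      derivable G D t (All a A)
  | d_alle (G D : ctx) a t A B :
      derivable G D t (All a A) ->
      derivable G D t (tsubst1 a B A)
  | d_B0i : derivable [fmap] [fmap] FF TBool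
  | d_B1i : derivable [fmap] [fmap] TT TBool
  | d_Be (G D : ctx) k t0 t1 t2 A :
      derivable G D t0 (iter k Sec TBool) ->
      derivable G D t1 A ->
      derivable G D t2 A ->
      derivable G D (If t0 t1 t2) A.

(* Main.v *)
Require Import Defs.
From mathcomp Require Import all_boot finmap.
From Stdlib Require Import Relations Classical.

(** Forgetting the modality and identifying the two arrows maps DLAL_B into
    System F with booleans.  Existence of a normal form follows from Girard's
    reducibility candidates: [Sec A] is interpreted as [A], [Lolli] and [Imp]
    as the same function space, and [TBool] as the set of all strongly
    normalizing terms, which makes the interpretation of [iter k Sec TBool]
    independent of [k].  Uniqueness holds for all untyped terms, by
    Takahashi's complete developments. *)

Local Open Scope fset_scope.
Local Open Scope fmap_scope.

(** * Substitution calculus *)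

(** The pointwise hypothesis lets substitutions be compared without functional extensionality. *)
Lemma subst_ext {s r : nat -> term} (t : term) : s =1 r -> subst s t = subst r t.
Proof.
elim: t s r => //=.
- by move=> t IH s r e; congr Abs; apply: IH => -[|n] //=; rewrite e.
- by move=> t IHt u IHu f g e; rewrite (IHt _ _ e) (IHu _ _ e).
- by move=> t IHt u IHu v IHv f g e; rewrite (IHt _ _ e) (IHu _ _ e) (IHv _ _ e).
Qed.

Lemma subst_Var (t : term) : subst Var t = t.
Proof.
elim: t => //= [t IH|t -> u ->|t -> u -> v ->] //.
by congr Abs; rewrite -[RHS]IH; apply: subst_ext => -[].
Qed.

Lemma ren_as_subst (f : nat -> nat) (t : term) : ren f t = subst (Var \o f) t.
Proof.
elim: t f => //= [t IH|t IHt u IHu|t IHt u IHu v IHv] f; rewrite ?IH ?IHt ?IHu ?IHv //.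
by congr Abs; apply: subst_ext => -[].
Qed.

Lemma subst_ren (s : nat -> term) (f : nat -> nat) (t : term) :
  subst s (ren f t) = subst (s \o f) t.
Proof.
elim: t s f => //= [t IH|t IHt u IHu|t IHt u IHu v IHv] s f; rewrite ?IH ?IHt ?IHu ?IHv //.
by congr Abs; apply: subst_ext => -[].
Qed.

Lemma ren_ren (g f : nat -> nat) (t : term) : ren g (ren f t) = ren (g \o f) t.
Proof. by rewrite [LHS]ren_as_subst subst_ren ren_as_subst. Qed.

Lemma ren_subst (f : nat -> nat) (s : nat -> term) (t : term) :
  ren f (subst s t) = subst (ren f \o s) t.
Proof.
elim: t s f => //= [t IH|t IHt u IHu|t IHt u IHu v IHv] s f; rewrite ?IH ?IHt ?IHu ?IHv //.
by congr Abs; apply: subst_ext => -[|n] //=; rewrite !ren_ren.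
Qed.

(** Under a binder a shift meets a substitution, so the mixed laws [subst_ren] and [ren_subst] have
    to come first. *)
Lemma subst_subst (r s : nat -> term) (t : term) :
  subst r (subst s t) = subst (subst r \o s) t.
Proof.
elim: t r s => //= [t IH|t IHt u IHu|t IHt u IHu v IHv] r s; rewrite ?IH ?IHt ?IHu ?IHv //.
by congr Abs; apply: subst_ext => -[|n] //=; rewrite subst_ren ren_subst.
Qed.

(** Makes beta contraction stable under substitution, for parallel as well as single steps. *)
Lemma subst_inst (s : nat -> term) (u t : term) :
  subst s (inst u t) = inst (subst s u) (subst (up s) t).
Proof.
rewrite /inst !subst_subst; apply: subst_ext => -[|n] //=.
by rewrite subst_ren subst_Var.
Qed.

(** Bridge from named binders to contraction: instantiating the body of [Lam x t] updates the
    environment at [x], the form in which the induction hypotheses of [soundness] apply. *)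
Lemma inst_Lam_body (s : nat -> term) (x : nat) (u t : term) :
  inst u (subst (up s) (ren (bind_var x) t)) =
  subst (fun y => if y == x then u else s y) t.
Proof.
rewrite subst_ren /inst subst_subst; apply: subst_ext => y /=.
by rewrite /bind_var; case: eqP => //= _; rewrite subst_ren subst_Var.
Qed.

(** * Confluence *)

(** One closure of the united root relations gives each induction a single congruence case per
    subterm position. *)
Definition step : relation term := ctx_closure (union term beta_root delta_root).

Lemma ctx_closure_mono (R S : relation term) :
  inclusion term R S -> inclusion term (ctx_closure R) (ctx_closure S).
Proof. by move=> sub t u; elim=> *; constructor; auto. Qed.

Lemma betadeltaE (t u : term) : betadelta t u <-> step t u.
Proof.
split; first by case; apply: ctx_closure_mono => ? ? ?; [left|right].
elim=> [{}t t' [r|r]|||||| ]; first by left; constructor.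
- by right; constructor.
all: by move=> *; match goal with H : betadelta _ _ |- _ => case: H end;
  move=> r; [left|right]; constructor.
Qed.

(** Parallel reduction of Tait and Martin-Löf extended by delta: some of the redexes already present
    are contracted at once. *)
Inductive par : term -> term -> Prop :=
  | par_var x : par (Var x) (Var x)
  | par_FF : par FF FF
  | par_TT : par TT TT
  | par_abs t t' : par t t' -> par (Abs t) (Abs t')
  | par_app t t' u u' : par t t' -> par u u' -> par (App t u) (App t' u')
  | par_if t t' u u' v v' :
      par t t' -> par u u' -> par v v' -> par (If t u v) (If t' u' v')
  | par_beta t t' u u' :
      par t t' -> par u u' -> par (App (Abs t) u) (inst u' t')
  | par_T u u' v : par u u' -> par (If TT u v) u'
  | par_F u v v' : par v v' -> par (If FF u v) v'.

Lemma par_refl (t : term) : par t t.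
Proof. by elim: t => *; constructor. Qed.

Lemma par_ren (f : nat -> nat) (t t' : term) :
  par t t' -> par (ren f t) (ren f t').
Proof.
move=> p; elim: p f => /=; try by move=> *; constructor; auto.
move=> {}t {}t' u u' _ IHt _ IHu f.
rewrite [ren f (inst _ _)]ren_as_subst subst_inst.
rewrite -ren_as_subst (_ : subst _ t' = ren (up_ren f) t').
  by constructor.
by rewrite ren_as_subst; apply: subst_ext => -[].
Qed.

Lemma par_subst (s r : nat -> term) (t t' : term) :
  (forall x, par (s x) (r x)) -> par t t' -> par (subst s t) (subst r t').
Proof.
move=> sr p; elim: p s r sr => /=; try by move=> *; try constructor; auto.
- move=> {}t {}t' _ IH s r sr; constructor; apply: IH => -[|n] /=; first exact: par_refl.
  exact: par_ren.
- move=> {}t {}t' u u' _ IHt _ IHu s r sr; rewrite subst_inst.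
  constructor; last exact: IHu.
  by apply: IHt => -[|n] /=; [exact: par_refl|exact: par_ren].
Qed.

Lemma par_inst (u u' t t' : term) :
  par u u' -> par t t' -> par (inst u t) (inst u' t').
Proof. by move=> pu; apply: par_subst => -[|n] //=; apply: par_refl. Qed.

(** The maximal parallel step: redexes present in the term are contracted or discarded, newly
    created ones are left. *)
Fixpoint development (t : term) : term :=
  match t with
  | Var _ | FF | TT => t
  | Abs t => Abs (development t)
  | App (Abs t) u => inst (development u) (development t)
  | App t u => App (development t) (development u)
  | If TT u _ => development u
  | If FF _ v => development v
  | If t u v => If (development t) (development u) (development v)
  end.

(** A parallel reduct can still contract what remains of the redexes of [t]. As the target depends
    on [t] alone, all parallel reducts of [t] meet there. *)
Lemma par_development (t t' : term) : par t t' -> par t' (development t).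
Proof.
elim=> //=; try by constructor.
- move=> {}t {}t' u u' pt IHt pu IHu; case: t pt IHt => *; try by constructor.
  (* An abstraction reduces only to abstractions, so the beta redex survives in the reduct; the
     second inversion relates the bodies. *)
  match goal with H : par (Abs _) _ |- _ => inversion H; subst end.
  match goal with H : par (Abs _) (development _) |- _ => inversion H; subst end.
  by constructor.
- move=> {}t {}t' u u' v v' pt IHt pu IHu pv IHv.
  case: t pt IHt => [x||||a b|a b c] pt IHt; try by constructor.
  + by inversion pt; subst; constructor.
  + by inversion pt; subst; constructor.
- by move=> *; apply: par_inst.
Qed.

Lemma step_par (t u : term) : step t u -> par t u.
Proof.
elim; try by move=> *; constructor=> //; apply: par_refl.
by move=> ? ? [] [] *; constructor; apply: par_refl.
Qed.

Lemma par_betadelta_star (t u : term) :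
  par t u -> clos_refl_trans term betadelta t u.
Proof.
have cong (F : term -> term) : (forall a b, step a b -> step (F a) (F b)) ->
    forall a b, clos_refl_trans term betadelta a b ->
    clos_refl_trans term betadelta (F a) (F b).
  move=> cF a b; elim=> [{}a {}b /betadeltaE /cF /betadeltaE|{}a|{}a {}b c _ + _].
  - exact: rt_step.
  - exact: rt_refl.
  - exact: rt_trans.
have cabs := cong Abs (fun _ _ => @cc_abs _ _ _).
have capp a b c d (ab : clos_refl_trans term betadelta a b)
    (cd : clos_refl_trans term betadelta c d) :
    clos_refl_trans term betadelta (App a c) (App b d).
  apply: (rt_trans _ _ _ (App b c)).
  - by apply: (cong (App^~ c)) ab => *; apply: cc_appl.
  - by apply: cong cd => *; apply: cc_appr.
elim=> //; try by move=> *; apply: rt_refl.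
- by move=> *; apply: cabs.
- by move=> *; apply: capp.
- move=> {}t t' {}u u' v v' _ ht _ hu _ hv.
  apply: (rt_trans _ _ _ (If t' u v)).
    by apply: (cong (fun z => If z u v)) ht => *; apply: cc_if0.
  apply: (rt_trans _ _ _ (If t' u' v)).
    by apply: (cong (fun z => If t' z v)) hu => *; apply: cc_if1.
  by apply: cong hv => *; apply: cc_if2.
- move=> {}t t' {}u u' _ ht _ hu.
  apply: (rt_trans _ _ _ (App (Abs t') u')); first by apply: capp => //; apply: cabs.
  by apply: rt_step; left; constructor.
- move=> {}u u' v _; apply: rt_trans; apply: rt_step; right; do 2 constructor.
- move=> {}u v v' _; apply: rt_trans; apply: rt_step; right; do 2 constructor.
Qed.

Lemma betadelta_strip (t u v : term) :
  par t u -> clos_refl_trans_1n term betadelta t v ->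
  exists2 w, clos_refl_trans term betadelta u w & par v w.
Proof.
move=> tu tv; elim: tv u tu => [{}t u tu|{}t t' {}v /betadeltaE /step_par tt' _ IH u tu].
  by exists u => //; apply: rt_refl.
(* The peak formed by [u] and [t'] closes at [development t], from which the induction continues. *)
have [w t'w vw] := IH _ (par_development _ _ tt').
by exists w => //; apply: rt_trans t'w; apply/par_betadelta_star/par_development.
Qed.

Lemma betadelta_confluent (t u v : term) :
  clos_refl_trans term betadelta t u -> clos_refl_trans term betadelta t v ->
  exists2 w, clos_refl_trans term betadelta u w &
             clos_refl_trans term betadelta v w.
Proof.
move=> tu; elim: (clos_rt_rt1n _ _ _ _ tu) v => {tu} [{}t|{}t t' {}u /betadeltaE /step_par tt' _ IH] v tv.
  by exists v => //; apply: rt_refl.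
have [w t'w vw] := betadelta_strip _ _ _ tt' (clos_rt_rt1n _ _ _ _ tv).
have [z uz wz] := IH _ t'w.
by exists z => //; apply: rt_trans wz; apply: par_betadelta_star.
Qed.

Lemma normal_star (t u : term) :
  normal t -> clos_refl_trans term betadelta t u -> t = u.
Proof. by move=> nt tu; case: (clos_rt_rt1n _ _ _ _ tu) nt => // v w tv _ nt; case: nt; exists v. Qed.

Lemma normal_form_unique (t n m : term) :
  is_normal_form_of t n -> is_normal_form_of t m -> n = m.
Proof.
move=> [tn nn] [tm nm]; have [w nw mw] := betadelta_confluent _ _ _ tn tm.
by rewrite (normal_star _ _ nn nw) (normal_star _ _ nm mw).
Qed.

(** * Strong normalization and candidates *)

(** Accessibility along reducts provides induction on reduction directly, without infinite
    sequences. *)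
Definition SN : term -> Prop := Acc (fun u t => step t u).

Lemma SN_normal_form (t : term) : SN t -> exists n, is_normal_form_of t n.
Proof.
(* Excluded middle decides whether [t] is reducible; if so, it inherits a normal form from a
   reduct. *)
elim=> {}t _ IH; case: (classic (exists u, betadelta t u)) => [[u tu]|nt].
  have [n [un nn]] := IH u (proj1 (betadeltaE _ _) tu).
  by exists n; split=> //; apply: rt_trans un; apply: rt_step.
by exists t; split=> //; apply: rt_refl.
Qed.

Lemma step_subst (s : nat -> term) (t u : term) :
  step t u -> step (subst s t) (subst s u).
Proof.
rewrite /step => tu; elim: tu s => /=; try by move=> *; constructor; auto.
move=> {}t {}u [[a b]|[a b|a b]] s /=; apply: cc_root.
- by rewrite subst_inst; left; constructor.
- by right; constructor.
- by right; constructor.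
Qed.

(** Every step of [t] is mirrored by a step of its instance, so the induction runs on the
    instance. *)
Lemma SN_subst_inv (s : nat -> term) (t : term) : SN (subst s t) -> SN t.
Proof.
move=> SNst; move: {-2}(subst s t) SNst (erefl (subst s t)) => u SNu.
elim: SNu t => {}u _ IH t e; constructor => t' tt'.
by apply: (IH (subst s t')) => //; rewrite -e; apply: step_subst.
Qed.

(** Neutral terms create no root beta redex when applied. [TT] and [FF] are included, as
    conditionals are treated separately by [candidate_If]. *)
Definition neutral (t : term) : bool := if t is Abs _ then false else true.

(** Girard's conditions CR1, CR2 and CR3. *)
Record candidate (C : term -> Prop) : Prop := Candidate {
  candidate_SN : forall t, C t -> SN t;
  candidate_step : forall t u, C t -> step t u -> C u;
  candidate_neutral :
    forall t, neutral t -> (forall u, step t u -> C u) -> C t }.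

(** A variable is neutral and has no reducts, so CR3 applies vacuously; in particular candidates are
    inhabited. *)
Lemma candidate_Var (C : term -> Prop) (x : nat) : candidate C -> C (Var x).
Proof.
move=> cC; apply: (candidate_neutral _ cC) => // u st.
by inversion st; subst; match goal with H : union _ _ _ _ _ |- _ => case: H => r; inversion r end.
Qed.

Lemma candidate_SNset : candidate SN.
Proof.
split=> [t SNt|t u SNt|t _ SNt]; [exact: SNt|exact: Acc_inv SNt u|exact: Acc_intro].
Qed.

Definition arrow (C D : term -> Prop) (t : term) : Prop :=
  forall u, C u -> D (App t u).

Lemma candidate_arrow (C D : term -> Prop) :
  candidate C -> candidate D -> candidate (arrow C D).
Proof.
move=> cC cD; split.
(* Applying [t] to a variable, which lies in [C], gives a strongly normalizing term that mirrors
   every step of [t]. *)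
- move=> t /(_ _ (candidate_Var _ 0 cC)) /(candidate_SN _ cD).
  move=> SNt; move: {-2}(App t _) SNt (erefl (App t (Var 0))) => u SNu.
  elim: SNu t => {}u _ IH t e; constructor => t' tt'.
  by apply: (IH (App t' (Var 0))) => //; rewrite -e; apply: cc_appl.
- move=> t t' Ct tt' u Cu; apply: (candidate_step _ cD) (Ct u Cu) _.
  exact: cc_appl.
- move=> t nt ht u Cu.
  (* Since [t] is neutral, [App t u] reduces only inside [t] or inside [u]; steps inside [u] are
     absorbed by this induction. *)
  elim: (candidate_SN _ cC _ Cu) (Cu) => {Cu}u _ IH Cu.
  apply: (candidate_neutral _ cD) => // v st.
  inversion st as [a b [r|r]| |a b c r|a b c r| | |]; subst.
  + by inversion r; subst.
  + by inversion r.
  + exact: ht.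
  + by apply: IH => //; apply: (candidate_step _ cC) Cu _.
Qed.

Lemma arrow_Abs (C D : term -> Prop) (t : term) :
  candidate C -> candidate D -> (forall u, C u -> D (inst u t)) ->
  arrow C D (Abs t).
Proof.
move=> cC cD ht u Cu.
(* The instance of [t] at a variable lies in [D], hence is strongly normalizing; nested inductions
   on [t] and [u] then treat all reducts of the redex. *)
have SNt : SN t.
  by apply/SN_subst_inv/(candidate_SN _ cD)/ht/(candidate_Var _ 0 cC).
elim: SNt ht u Cu => {}t _ IHt ht u Cu.
elim: (candidate_SN _ cC _ Cu) (Cu) => {Cu}u _ IHu Cu.
apply: (candidate_neutral _ cD) => // v st.
inversion st as [a b [r|r]| |a b c r|a b c r| | |]; subst.
- by inversion r; subst; apply: ht.
- by inversion r.
- inversion r as [a e [q|q]|a t' q| | | | |]; subst; try by inversion q.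
  (* The hypothesis on instances passes to the reduced body, because [D] is closed under
     reduction. *)
  apply: IHt => // w Cw; apply: (candidate_step _ cD) (ht _ Cw) _.
  exact: step_subst.
- by apply: IHu => //; apply: (candidate_step _ cC) Cu _.
Qed.

(** Whichever branch is selected lies in [C], so strong normalization of the condition suffices.
    This is what makes [SN] an adequate meaning for [TBool]. *)
Lemma candidate_If (C : term -> Prop) (t u v : term) :
  candidate C -> SN t -> C u -> C v -> C (If t u v).
Proof.
move=> cC SNt; elim: SNt u v => {}t _ IHt u v Cu.
elim: (candidate_SN _ cC _ Cu) (Cu) v => {Cu}u _ IHu Cu v Cv.
elim: (candidate_SN _ cC _ Cv) (Cv) => {Cv}v _ IHv Cv.
apply: (candidate_neutral _ cC) => // w st.
inversion st as [a b [r|r]| | | |a b c d r|a b c d r|a b c d r]; subst.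
- by inversion r.
- by inversion r; subst.
- exact: IHt.
- by apply: IHu => //; apply: (candidate_step _ cC) Cu _.
- by apply: IHv => //; apply: (candidate_step _ cC) Cv _.
Qed.

(** * Interpretation of types *)

Definition vcons {T : Type} (c : T) (rho : nat -> T) (n : nat) : T :=
  if n is m.+1 then rho m else c.

Fixpoint interp (rho : nat -> term -> Prop) (A : ty) : term -> Prop :=
  match A with
  | TVar a => rho a
  | Lolli A B | Imp A B => arrow (interp rho A) (interp rho B)
  | Sec A => interp rho A
  | TAll A => fun t => forall C, candidate C -> interp (vcons C rho) A t
  | TBool => SN
  end.

Lemma candidate_interp (rho : nat -> term -> Prop) (A : ty) :
  (forall a, candidate (rho a)) -> candidate (interp rho A).
Proof.
elim: A rho => /=.
- by move=> a rho; apply.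
- by move=> A IHA B IHB rho crho; apply: candidate_arrow; auto.
- by move=> A IHA B IHB rho crho; apply: candidate_arrow; auto.
- auto.
- move=> A IH rho crho.
  have cA C : candidate C -> candidate (interp (vcons C rho) A).
    by move=> cC; apply: IH => -[].
  split.
  (* [SN] serves as a concrete candidate at which to instantiate the quantifier. *)
  + by move=> t /(_ _ candidate_SNset); apply/candidate_SN/cA/candidate_SNset.
  + by move=> t u ht tu C cC; apply: (candidate_step _ (cA _ cC)) (ht _ cC) tu.
  + move=> t nt ht C cC; apply: (candidate_neutral _ (cA _ cC)) => // u tu.
    exact: ht.
- by move=> rho _; exact: candidate_SNset.
Qed.

Lemma arrow_iff (C C' D D' : term -> Prop) (t : term) :
  (forall u, C u <-> C' u) -> (forall u, D u <-> D' u) ->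
  arrow C D t <-> arrow C' D' t.
Proof.
by move=> eC eD; split=> h u Cu; apply/eD/h/eC.
Qed.

(** Agreement is asked only on free variables, which is what the side condition of quantifier
    introduction supplies. *)
Lemma interp_ext (rho rho' : nat -> term -> Prop) (A : ty) (t : term) :
  (forall a, tfree a A -> forall u, rho a u <-> rho' a u) ->
  interp rho A t <-> interp rho' A t.
Proof.
elim: A rho rho' t => //=.
- by move=> a rho rho' t; apply.
- move=> A IHA B IHB rho rho' t e; apply: arrow_iff => u.
    by apply: IHA => a fa; apply: e; rewrite fa.
  by apply: IHB => a fa; apply: e; rewrite fa orbT.
- move=> A IHA B IHB rho rho' t e; apply: arrow_iff => u.
    by apply: IHA => a fa; apply: e; rewrite fa.
  by apply: IHB => a fa; apply: e; rewrite fa orbT.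
- move=> A IH rho rho' t e.
  have eC C : interp (vcons C rho) A t <-> interp (vcons C rho') A t.
    by apply: IH => -[|a] //=; apply: e.
  by split=> h C cC; apply/eC/h.
Qed.

Lemma interp_tren (rho : nat -> term -> Prop) (f : nat -> nat) (A : ty) (t : term) :
  interp rho (tren f A) t <-> interp (rho \o f) A t.
Proof.
elim: A rho f t => //=.
- by move=> A IHA B IHB rho f t; apply: arrow_iff => u; auto.
- by move=> A IHA B IHB rho f t; apply: arrow_iff => u; auto.
- move=> A IH rho f t.
  have eC C : interp (vcons C rho) (tren (up_ren f) A) t <->
              interp (vcons C (rho \o f)) A t.
    by rewrite IH; apply: interp_ext => -[].
  by split=> h C cC; apply/eC/h.
Qed.

Lemma interp_tsubst (rho : nat -> term -> Prop) (s : nat -> ty) (A : ty) (t : term) :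
  interp rho (tsubst s A) t <-> interp (fun a => interp rho (s a)) A t.
Proof.
elim: A rho s t => //=.
- by move=> A IHA B IHB rho s t; apply: arrow_iff => u; auto.
- by move=> A IHA B IHB rho s t; apply: arrow_iff => u; auto.
- move=> A IH rho s t.
  have eC C : interp (vcons C rho) (tsubst (tup s) A) t <->
              interp (vcons C (fun a => interp rho (s a))) A t.
    by rewrite IH; apply: interp_ext => -[|a] _ u //=; rewrite interp_tren.
  by split=> h C cC; apply/eC/h.
Qed.

Lemma interp_All (rho : nat -> term -> Prop) (a : nat) (A : ty) (t : term) :
  interp rho (All a A) t <->
  forall C, candidate C -> interp (fun b => if b == a then C else rho b) A t.
Proof.
have e C : interp (vcons C rho) (tren (bind_var a) A) t <->
           interp (fun b => if b == a then C else rho b) A t.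
  rewrite interp_tren; apply: interp_ext => b _ u /=.
  by rewrite /bind_var; case: eqP.
by split=> h C cC; apply/e/h.
Qed.

Lemma interp_iter_Sec (rho : nat -> term -> Prop) (k : nat) (A : ty) :
  interp rho (iter k Sec A) = interp rho A.
Proof. by elim: k. Qed.

(** * Soundness of typing *)

Definition separate (G H : ctx) : Prop := forall x, x \in G -> x \in H -> False.

(** The first two facts serve [derivable_separate], the last two let realizers of a union be
    split. *)
Lemma pairwise_disjoint4 (G1 D1 G2 D2 : ctx) :
  pairwise_disjoint [:: G1; D1; G2; D2] ->
  [/\ separate G1 D2, separate D1 G2, separate G1 G2 & separate D1 D2].
Proof.
rewrite /pairwise_disjoint /= !andbT => /and3P [/and3P [_ h2 h3] /andP [h4 h5] _].
by split=> x xG xH; [move/fdisjointP: h3|move/fdisjointP: h4|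
  move/fdisjointP: h2|move/fdisjointP: h5] => /(_ x xG); rewrite xH.
Qed.

(** Ensures that updating an environment at a variable of one context leaves the other context
    realized. *)
Lemma derivable_separate (G D : ctx) (t : term) (A : ty) :
  derivable G D t A -> separate G D.
Proof.
elim=> {G D t A} //.
- move=> G D x t A B xD _ IH y yG yD; apply: (IH y) => //.
  by rewrite mem_setf inE /= yD orbT.
- move=> G1 D1 G2 D2 t u A B /pairwise_disjoint4 [s1 s2 _ _] _ IH1 _ IH2 y.
  rewrite !mem_catf => /orP [yG|yG] /orP [yD|yD];
    [exact: IH1 yG yD|exact: s1 yG yD|exact: s2 yD yG|exact: IH2 yG yD].
- move=> G D x t A B xD _ IH y yG yD; apply: (IH y) => //.
  by rewrite mem_setf inE /= yG orbT.
- move=> G D z t u A B C zG zD _ IH _ _ y; rewrite mem_setf inE /= => /orP [/eqP ->|yG] yD.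
    by rewrite yD in zD.
  exact: IH yG yD.
- move=> G1 D1 G2 D2 t A dis _ IH1 y.
  have [s1 s2 _ _] := pairwise_disjoint4 _ _ _ _ dis.
  rewrite !mem_catf => /orP [yG|yG] /orP [yD|yD];
    [exact: IH1 yG yD|exact: s1 yG yD|exact: s2 yD yG|].
  (* The added contexts come from no premise, so their disjointness is read off the side
     condition. *)
  move: dis; rewrite /pairwise_disjoint /= !andbT => /and3P [_ _ /fdisjointP /(_ y yG)].
  by rewrite yD.
- move=> G D x1 x2 x t A B _ _ _ _ xD _ IH y.
  rewrite mem_setf inE /= => /orP [/eqP ->|yG] yD; first by rewrite yD in xD.
  by apply: IH yD; rewrite !mem_setf !inE /= ?mem_setf ?inE /= yG !orbT.
- move=> G D t A; rewrite /pairwise_disjoint /= !andbT => /fdisjointP dis _ _ y yG yD.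
  by move: (dis y yG); rewrite yD.
- move=> G1 D1 G2 D2 x t u A B /pairwise_disjoint4 [s1 s2 _ _] _ _ IH1 _ IH2 y.
  rewrite !mem_catf => /orP [yG|yG] /orP [yD|yD];
    [exact: IH1 yG yD|exact: s1 yG yD|exact: s2 yD yG|].
  by apply: (IH2 y yG); rewrite mem_setf inE /= yD orbT.
Qed.

Definition realizes (rho : nat -> term -> Prop) (s : nat -> term) (G : ctx) : Prop :=
  forall x A, G.[? x] = Some A -> interp rho A (s x).

Lemma fnd_mem (G : ctx) (x : nat) (A : ty) : G.[? x] = Some A -> x \in G.
Proof. by case: fndP. Qed.

(** Separateness prevents the right-biased union from hiding entries of [G]. *)
Lemma realizes_cat (rho : nat -> term -> Prop) (s : nat -> term) (G H : ctx) :
  separate G H -> realizes rho s (catf G H) -> realizes rho s G /\ realizes rho s H.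
Proof.
move=> dis h; split=> x A e; apply: h; rewrite fnd_cat.
  by case: ifP => // xH; case: (dis x (fnd_mem _ _ _ e) xH).
by rewrite (fnd_mem _ _ _ e).
Qed.

Lemma realizes_set (rho : nat -> term -> Prop) (s : nat -> term) (G : ctx) (x : nat) (A : ty) :
  x \notin G -> realizes rho s G.[x <- A] -> realizes rho s G /\ interp rho A (s x).
Proof.
move=> xG h; split=> [y B e|]; apply: h; rewrite fnd_set ?eqxx //.
by case: eqP => // eyx; rewrite -eyx (fnd_mem _ _ _ e) in xG.
Qed.

Lemma realizes_ext_in (rho : nat -> term -> Prop) (s s' : nat -> term) (G : ctx) :
  (forall x, x \in G -> s x = s' x) -> realizes rho s G -> realizes rho s' G.
Proof. by move=> e h x A eA; rewrite -e ?(fnd_mem _ _ _ eA) //; apply: h. Qed.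

Lemma fnd_secctx (D : ctx) (x : nat) : (secctx D).[? x] = omap Sec D.[? x].
Proof.
case: (boolP (x \in D)) => xD; last by rewrite !not_fnd.
by rewrite (in_fnd xD) (in_fnd (f := secctx D) xD) ffunE.
Qed.

Lemma realizes_secctx (rho : nat -> term -> Prop) (s : nat -> term) (D : ctx) :
  realizes rho s (secctx D) -> realizes rho s D.
Proof. by move=> h x A e; apply: (h x (Sec A)); rewrite fnd_secctx e. Qed.

Lemma realizes_update (rho : nat -> term -> Prop) (s : nat -> term) (G : ctx) (x : nat)
    (A : ty) (u : term) :
  realizes rho s G -> interp rho A u ->
  realizes rho (fun y => if y == x then u else s y) G.[x <- A].
Proof.
move=> h hu y B; rewrite fnd_set; case: eqP => [_ [<-] //|_]; exact: h.
Qed.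

Lemma realizes_update_notin (rho : nat -> term -> Prop) (s : nat -> term) (G : ctx)
    (x : nat) (u : term) :
  x \notin G -> realizes rho s G -> realizes rho (fun y => if y == x then u else s y) G.
Proof.
move=> xG; apply: realizes_ext_in => y yG.
by case: eqP => // e; rewrite -e yG in xG.
Qed.

Lemma realizes_tfree (rho : nat -> term -> Prop) (s : nat -> term) (G : ctx) (a : nat)
    (C : term -> Prop) :
  ~ tfree_ctx a G -> realizes rho s G ->
  realizes (fun b => if b == a then C else rho b) s G.
Proof.
move=> na h x A e; have /interp_ext := h x A e; apply=> b fb u.
by case: eqP fb => // -> fb; case: na; exists x, A.
Qed.

Lemma separate_set (G D : ctx) (x : nat) (A : ty) :
  separate G D.[x <- A] -> x \notin G.
Proof. by move=> dis; apply/negP => /dis; apply; rewrite mem_setf inE eqxx. Qed.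

(** Adequacy, general in [s] and [rho] because abstraction updates the environment and quantifier
    introduction updates the valuation. *)
Lemma soundness (G D : ctx) (t : term) (A : ty) :
  derivable G D t A ->
  forall rho s, (forall a, candidate (rho a)) ->
  realizes rho s G -> realizes rho s D -> interp rho A (subst s t).
Proof.
elim=> {G D t A}.
- by move=> x A rho s _ _ /(_ x A) /=; apply; rewrite fnd_set eqxx.
- move=> G D x t A B xD der IH rho s crho hG hD /=.
  apply: arrow_Abs; try exact: candidate_interp.
  move=> u hu; rewrite inst_Lam_body; apply: IH => //; last exact: realizes_update.
  apply: realizes_update_notin => //.
  exact: separate_set (derivable_separate _ _ _ _ der).
- move=> G1 D1 G2 D2 t u A B /pairwise_disjoint4 [_ _ sG sD] _ IHt _ IHu rho s crho.
  move=> /(realizes_cat _ _ _ _ sG) [hG1 hG2] /(realizes_cat _ _ _ _ sD) [hD1 hD2] /=.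
  by apply: (IHt rho s) => //; apply: IHu.
- move=> G D x t A B xG der IH rho s crho hG hD /=.
  apply: arrow_Abs; try exact: candidate_interp.
  move=> u hu; rewrite inst_Lam_body; apply: IH => //; first exact: realizes_update.
  apply: realizes_update_notin => //; apply/negP => xD.
  by apply: (derivable_separate _ _ _ _ der x) => //; rewrite mem_setf inE eqxx.
- move=> G D z t u A B C zG zD _ IHt _ IHu rho s crho.
  move=> /(realizes_set _ _ _ _ _ zG) [hG hz] hD /=.
  apply: (IHt rho s) => //; apply: IHu => // x E; first by rewrite fnd_fmap0.
  by rewrite fnd_set; case: eqP => [-> [<-]|_] //; rewrite fnd_fmap0.
- move=> G D t u A B _ IHt _ IHu rho s crho hG hD /=.
  by apply: (IHt rho s) => //; apply: IHu => // x E; rewrite fnd_fmap0.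
- move=> G1 D1 G2 D2 t A /pairwise_disjoint4 [_ _ sG sD] _ IHt rho s crho.
  move=> /(realizes_cat _ _ _ _ sG) [hG1 _] /(realizes_cat _ _ _ _ sD) [hD1 _].
  exact: IHt.
- move=> G D x1 x2 x t A B x12 x1G x2G xG xD der IH rho s crho.
  move=> /(realizes_set _ _ _ _ _ xG) [hG hx] hD; rewrite subst_ren.
  have dis := derivable_separate _ _ _ _ der.
  apply: IH => //.
    move=> y E; rewrite !fnd_set /=; case: (y == x2) => [[<-]|]; first by rewrite orbT.
    by case: (y == x1) => [[<-] //|]; apply: hG.
  (* The renaming fixes every variable of [D], since [x1] and [x2] lie in the disjoint context of
     the premise. *)
  apply: realizes_ext_in hD => y yD /=; case: ifP => // /orP e.
  by case: (dis y) => //; rewrite !mem_setf !inE ?mem_setf ?inE; case: e => ->; rewrite ?orbT.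
- move=> G D t A; rewrite /pairwise_disjoint /= !andbT => dis _ IH rho s crho hG.
  move=> /realizes_secctx hD; apply: IH => // x E; first by rewrite fnd_fmap0.
  by rewrite fnd_cat; case: ifP => _; [exact: hD|exact: hG].
- move=> G1 D1 G2 D2 x t u A B /pairwise_disjoint4 [_ _ sG sD] xD _ IHu der IHt rho s crho.
  move=> /(realizes_cat _ _ _ _ sG) [hG1 hG2] /(realizes_cat _ _ _ _ sD) [hD1 hD2].
  rewrite /subst1 subst_subst.
  (* The composite substitution is [s] updated at [x] with the instance of [u], which realizes
     [Sec A]. *)
  rewrite (@subst_ext _ (fun y => if y == x then subst s u else s y)); last first.
    by move=> y /=; case: eqP.
  apply: IHt => //; last by apply: realizes_update => //; apply: IHu.
  apply: realizes_update_notin => //.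
  exact: separate_set (derivable_separate _ _ _ _ der).
- move=> G D a t A nG nD _ IH rho s crho hG hD; apply/interp_All => C cC.
  by apply: IH; [move=> b; case: eqP|exact: realizes_tfree|exact: realizes_tfree].
- move=> G D a t A B _ IH rho s crho hG hD; apply/interp_tsubst.
  (* The quantifier is instantiated at the candidate interpreting [B]. *)
  have /interp_All /(_ (interp rho B) (candidate_interp _ _ crho)) := IH rho s crho hG hD.
  by apply: (proj1 (interp_ext _ _ _ _ _)) => b _ u; case: eqP.
- by move=> *; constructor => u st; inversion st; subst;
    match goal with H : union _ _ _ _ _ |- _ => case: H => r; inversion r end.
- by move=> *; constructor => u st; inversion st; subst;
    match goal with H : union _ _ _ _ _ |- _ => case: H => r; inversion r end.
- move=> G D k t0 t1 t2 A _ IH0 _ IH1 _ IH2 rho s crho hG hD /=.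
  apply: candidate_If; [exact: candidate_interp| |exact: IH1|exact: IH2].
  by have := IH0 rho s crho hG hD; rewrite interp_iter_Sec.
Qed.

(** Variables belong to every candidate, so the identity substitution realizes any context once all
    type variables are read as [SN]. *)
Lemma derivable_SN (G D : ctx) (t : term) (A : ty) : derivable G D t A -> SN t.
Proof.
move=> h; rewrite -[t]subst_Var.
have cSN (a : nat) : candidate SN := candidate_SNset.
have real_Var (H : ctx) : realizes (fun=> SN) Var H.
  by move=> x B _; exact: (candidate_Var _ _ (candidate_interp _ B cSN)).
apply: (candidate_SN _ (candidate_interp _ A cSN)).
exact: (soundness _ _ _ _ h _ _ cSN (real_Var G) (real_Var D)).
Qed.

Theorem theorem4 (G D : ctx) (t : term) (A : ty) (h : derivable G D t A) :
  exists! n : term, is_normal_form_of t n.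
Proof.
have [n tn] := SN_normal_form _ (derivable_SN _ _ _ _ h).
by exists n; split=> // m; apply: normal_form_unique.
Qed.
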